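(* For all $m\in\mathbb{N}$, $\delta\in(0,1)$ and $\boldsymbol{\mu}\in\Delta_\mathbb{N}$, if $\boldsymbol{X}=(X_1,\dots,X_m)\sim\boldsymbol{\mu}^m$ and $\widehat{\boldsymbol{\mu}}_m$ is its empirical measure, then with probability at least $1-\delta$, $$\|\widehat{\boldsymbol{\mu}}_m-\boldsymbol{\mu}\|_{TV}\ge \frac{1}{4\sqrt2}\Phi_m(\widehat{\boldsymbol{\mu}}_m)-3\sqrt{\frac{\log(2/\delta)}{m}}.$$
   Context: $\Delta_\mathbb{N}$ is the set of probability distributions on $\mathbb{N}=\{1,2,\dots\}$. For $\boldsymbol{X}=(X_1,\dots,X_m)$ i.i.d. from $\boldsymbol{\mu}$, the empirical measure is $\widehat{\boldsymbol{\mu}}_m(i)=\frac1m\sum_{t=1}^m\mathbb{I}\{X_t=i\}$. $\|\boldsymbol{\mu}-\boldsymbol{\nu}\|_{TV}=\frac12\sum_{i}|\boldsymbol{\mu}(i)-\boldsymbol{\nu}(i)|$. $\Phi_m(\widehat{\boldsymbol{\mu}}_m):=\frac1{\sqrt m}\sum_{j\in\mathbb{N}}\sqrt{\widehat{\boldsymbol{\mu}}_m(j)}$. $\log$ is the natural logarithm. *)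

(* Defs.v *)
From HB Require Import structures.
From mathcomp Require Import all_boot all_order all_algebra.
From mathcomp Require Import all_classical all_reals all_analysis.
Set Implicit Arguments. Unset Strict Implicit. Unset Printing Implicit Defensive.
Import Order.TTheory GRing.Theory Num.Theory.
Import numFieldNormedType.Exports.
Local Open Scope ring_scope.
Local Open Scope classical_set_scope.

(* A probability distribution on a countable set, indexed by nat
   (the paper's N = {1,2,...} is relabelled by i |-> i-1). *)
Definition is_distribution (R : realType) (mu : nat -> R) : Prop :=
  (forall i, 0 <= mu i) /\ (series mu n @[n --> \oo] --> (1 : R)).

Definition empirical (R : realType) (m : nat) (x : {ffun 'I_m -> nat}) (i : nat) : R :=
  (\sum_(t < m) ((x t == i)%:R : R)) / m%:R.

Definition tv_dist (R : realType) (mu nu : nat -> R) : R :=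
  2^-1 * limn (series (fun i => `|mu i - nu i|)).

Definition Phi (R : realType) (m : nat) (muhat : nat -> R) : R :=
  (Num.sqrt (m%:R))^-1 * limn (series (fun j => Num.sqrt (muhat j))).

Definition prob_prod (R : realType) (m : nat) (mu : nat -> R)
    (E : {ffun 'I_m -> nat} -> Prop) : \bar R :=
  \esum_(x in [set x | E x]) (\prod_(t < m) mu (x t))%:E.

(* Main.v *)
Require Import Defs.
From HB Require Import structures.
From mathcomp Require Import all_boot all_order all_algebra.
From mathcomp Require Import all_classical all_reals all_analysis.
From mathcomp Require Import ring lra.
Import Order.TTheory GRing.Theory Num.Theory.
Import numFieldNormedType.Exports.
Local Open Scope ring_scope.

(** Multiplied by [2 m], the claim bounds from below
    [G = \sum_j (|S_j - m p_j| - c sqrt S_j)] with [S_j] the counts and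
    [c = 1 / (2 sqrt 2)].  In expectation, a symbol with [p_j >= 1/8] loses at most
    [c sqrt (m p_j) <= p_j sqrt m], and a symbol with [p_j < 1/8] loses nothing: the
    second and fourth moments give [E|S_j - m p_j| >= v / sqrt (3 v + 1)] for
    [v = m p_j (1 - p_j)].  Hence [E G >= - sqrt m].  Changing one observation moves
    [G] by at most [11/4], so an exponential-moment bound controls the lower tail.
    The argument runs on a finite alphabet whose last symbol collects the mass of all
    large integers; that mass then tends to 0. *)

(** * Expectation over independent draws from a finite alphabet *)

Section ProductExpectation.
Variables (R : realType) (T : finType) (p : T -> R).
Hypothesis p_ge0 : forall a, 0 <= p a.
Hypothesis p_sum1 : \sum_a p a = 1.

(** The mean over [n] independent draws, integrating out one draw at a time: moment bounds then
    follow by induction on [n]. Only lists of size [n] are ever evaluated. *)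
Fixpoint expect (n : nat) (f : seq T -> R) : R :=
  if n is k.+1 then \sum_a p a * expect k (fun s => f (a :: s)) else f [::].

Lemma le_expect n f g :
  (forall s, size s = n -> f s <= g s) -> expect n f <= expect n g.
Proof.
elim: n f g => [|n IHn] f g lefg /=; first exact: lefg.
apply: ler_sum => a _; apply: ler_wpM2l; first exact: p_ge0.
by apply: IHn => s ss; apply: lefg; rewrite /= ss.
Qed.

Lemma eq_expect n f g :
  (forall s, size s = n -> f s = g s) -> expect n f = expect n g.
Proof.
elim: n f g => [|n IHn] f g eqfg /=; first exact: eqfg.
by apply: eq_bigr => a _; congr (_ * _); apply: IHn => s ss; apply: eqfg; rewrite /= ss.
Qed.

Lemma expect_cst n c : expect n (fun=> c) = c.
Proof. by elim: n => //= n ->; rewrite -mulr_suml p_sum1 mul1r. Qed.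

Lemma expectD n f g : expect n (fun s => f s + g s) = expect n f + expect n g.
Proof.
elim: n f g => //= n IHn f g; rewrite -big_split /=.
by apply: eq_bigr => a _; rewrite IHn mulrDr.
Qed.

Lemma expectZ n c f : expect n (fun s => c * f s) = c * expect n f.
Proof.
elim: n f => //= n IHn f; rewrite mulr_sumr.
by apply: eq_bigr => a _; rewrite IHn mulrCA.
Qed.

Lemma expectN n f : expect n (fun s => - f s) = - expect n f.
Proof.
by rewrite -mulN1r -expectZ; apply: eq_expect => s _; rewrite mulN1r.
Qed.

Lemma expectB n f g : expect n (fun s => f s - g s) = expect n f - expect n g.
Proof. by rewrite expectD expectN. Qed.

Lemma expect_sum (I : Type) (r : seq I) (P : pred I) n (F : I -> seq T -> R) :
  expect n (fun s => \sum_(i <- r | P i) F i s) =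
  \sum_(i <- r | P i) expect n (F i).
Proof.
elim: r => [|i r IHr].
  rewrite big_nil -[RHS](expect_cst n); apply: eq_expect => s _.
  by rewrite big_nil.
rewrite big_cons -IHr; case: ifP => Pi; last first.
  by apply: eq_expect => s _; rewrite big_cons Pi.
by rewrite -expectD; apply: eq_expect => s _; rewrite big_cons Pi.
Qed.

(** Links the recursion to product weights on tuples, the form in which [prob_prod] is bounded from
    below. *)
Lemma expect_tuple n f :
  expect n f = \sum_(t : n.-tuple T) (\prod_(i < n) p (tnth t i)) * f t.
Proof.
elim: n f => [|n IHn] f /=.
  rewrite (big_pred1 [tuple]) ?big_ord0 ?mul1r // => t.
  by rewrite [t]tuple0 /= eqxx.
have := reindex (fun x : T * n.-tuple T => cons_tuple x.1 x.2).
move=> ->; last first.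
  exists (fun t : n.+1.-tuple T => (thead t, behead_tuple t)).
    by move=> [a t] _ /=; rewrite theadE; congr (_, _); apply: val_inj.
  by move=> t _; apply: val_inj => /=; rewrite [t in RHS]tuple_eta.
rewrite -(pair_bigA _ (fun a (t : n.-tuple T) =>
  (\prod_(i < n.+1) p (tnth (cons_tuple a t) i)) * f (cons_tuple a t))) /=.
apply: eq_bigr => a _; rewrite IHn mulr_sumr; apply: eq_bigr => t _.
rewrite big_ord_recl mulrA; congr (p _ * _ * _).
by apply: eq_bigr => i _; congr p; rewrite [RHS]tnthS.
Qed.

(** * Exponential moments under bounded differences *)

Lemma expR_le_quadratic (x : R) : x <= 1 / 3 -> expR x <= 1 + x + x ^+ 2.
Proof.
move=> xle.
have h0 : 0 < 1 - x / 2 by lra.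
(* Squaring this tangent bound gives [expR x <= (1 - x / 2) ^- 2], a rational function to compare
   with the quadratic. *)
have h1 : 1 - x / 2 <= expR (- (x / 2)) by have := expR_ge1Dx (- (x / 2)).
have h2 : expR x * (expR (- (x / 2))) ^+ 2 = 1.
  rewrite expr2 -!expRD -[RHS]expR0; congr expR; lra.
have h3 : (1 - x / 2) ^+ 2 <= (expR (- (x / 2))) ^+ 2.
  by rewrite ler_pXn2r // nnegrE ?expR_ge0 // ltW.
have h4 : expR x * (1 - x / 2) ^+ 2 <= 1.
  by rewrite -[leRHS]h2; apply: ler_wpM2l => //; apply: expR_ge0.
have h5 : 1 <= (1 + x + x ^+ 2) * (1 - x / 2) ^+ 2.
  have -> : (1 + x + x ^+ 2) * (1 - x / 2) ^+ 2
     = 1 + x ^+ 2 / 4 * (1 - 3 * x + x ^+ 2) by field.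
  (* The threshold [1 / 3] is what makes [1 - 3 * x] nonnegative here. *)
  rewrite lerDl mulr_ge0 ?divr_ge0 ?sqr_ge0 //.
  have := sqr_ge0 x; lra.
have h6 : 0 < (1 - x / 2) ^+ 2 by rewrite exprn_gt0.
by rewrite -(ler_pM2r h6) (le_trans h4).
Qed.

(** The lists have arbitrary length, so fixing the first letter of the argument preserves the
    property with the same [D]. *)
Definition bounded_differences (D : R) (f : seq T -> R) : Prop :=
  forall s1 s2 a b, `|f (s1 ++ a :: s2) - f (s1 ++ b :: s2)| <= D.

(** The mean is an average of values of [g], so each value lies within [D] of it. In the quadratic
    bound on the exponential of the centered variable, the linear term averages to 0. *)
Lemma expR_mgf_step (l D : R) (g : T -> R) :
  0 <= l -> l * D <= 1 / 3 -> (forall a b, `|g a - g b| <= D) ->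
  \sum_a p a * expR (l * g a) <= expR (l * (\sum_a p a * g a) + l ^+ 2 * D ^+ 2).
Proof.
move=> l0 lD gD; set gb := \sum_a p a * g a.
have dev a : `|g a - gb| <= D.
  have -> : g a - gb = \sum_b p b * (g a - g b).
    under eq_bigr do rewrite mulrBr.
    by rewrite sumrB -mulr_suml p_sum1 mul1r.
  apply: le_trans (ler_norm_sum _ _ _) _.
  rewrite -[leRHS]mul1r -p_sum1 mulr_suml; apply: ler_sum => b _.
  by rewrite normrM ger0_norm //; apply: ler_wpM2l.
have pt a : expR (l * (g a - gb)) <= 1 + l * (g a - gb) + l ^+ 2 * D ^+ 2.
  have := dev a; rewrite ler_norml => /andP[d1 d2].
  have D0 : 0 <= D by lra.
  apply: le_trans (expR_le_quadratic _ _) _.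
    by apply: le_trans lD; apply: ler_wpM2l.
  rewrite lerD2l exprMn; apply: ler_wpM2l; first exact: sqr_ge0.
  by rewrite -(real_normK (num_real _)) ler_pXn2r ?nnegrE.
have -> : \sum_a p a * expR (l * g a) =
    expR (l * gb) * \sum_a p a * expR (l * (g a - gb)).
  rewrite mulr_sumr; apply: eq_bigr => a _; rewrite mulrCA -expRD.
  by congr (_ * expR _); ring.
rewrite expRD; apply: ler_wpM2l; first exact: expR_ge0.
have /le_trans -> // : \sum_a p a * expR (l * (g a - gb)) <= 1 + l ^+ 2 * D ^+ 2.
  apply: le_trans (ler_sum _ (fun a _ => ler_wpM2l (p_ge0 a) (pt a))) _.
  under eq_bigr do rewrite mulrDr mulrDr mulr1.
  rewrite !big_split /= -mulr_suml p_sum1 mul1r.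
  have -> : \sum_a p a * (l * (g a - gb)) = 0.
    under eq_bigr do rewrite mulrCA mulrBr.
    by rewrite -mulr_sumr sumrB -/gb -mulr_suml p_sum1 mul1r subrr mulr0.
  by rewrite addr0.
exact: expR_ge1Dx.
Qed.

(** Conditional means given the first draw again differ by at most [D], so every draw costs one
    factor [expR (l ^+ 2 * D ^+ 2)]. *)
Lemma expect_expR_le (l D : R) n (f : seq T -> R) :
  0 <= l -> l * D <= 1 / 3 -> bounded_differences D f ->
  expect n (fun s => expR (l * f s)) <=
  expR (l * expect n f + n%:R * (l ^+ 2 * D ^+ 2)).
Proof.
move=> l0 lD; elim: n f => [|n IHn] f fD /=; first by rewrite mul0r addr0.
have IH a : p a * expect n (fun s => expR (l * f (a :: s))) <=
    p a * expR (l * expect n (fun s => f (a :: s))) *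
    expR (n%:R * (l ^+ 2 * D ^+ 2)).
  rewrite -mulrA -expRD; apply: ler_wpM2l => //.
  exact: IHn (fun s1 s2 => fD (a :: s1) s2).
apply: le_trans (ler_sum _ (fun a _ => IH a)) _.
rewrite -mulr_suml -nat1r mulrDl mul1r addrA (expRD (_ + _) (n%:R * _)).
apply: ler_wpM2r; first exact: expR_ge0.
apply: expR_mgf_step => // a b; rewrite -expectB.
have D0 : 0 <= D by apply: le_trans (normr_ge0 _) (fD [::] [::] a b).
rewrite ler_norml; apply/andP; split.
  rewrite -(expect_cst n (- D)); apply: le_expect => s _.
  by have := fD [::] s a b; rewrite ler_norml => /andP[].
rewrite -[leRHS](expect_cst n); apply: le_expect => s _.
by have := fD [::] s a b; rewrite ler_norml => /andP[].
Qed.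

(** * Moments of the count of a single symbol *)

Lemma sqrt_nat_le (n : nat) : Num.sqrt n%:R <= n%:R :> R.
Proof.
case: n => [|n]; first by rewrite sqrtr0.
rewrite -[leRHS]ger0_norm // -sqrtr_sqr ler_wsqrtr // expr2.
by rewrite ler_peMr // ler1n.
Qed.

Section OneSymbol.
Variable j : T.
Local Notation q := (p j).

Lemma prob_le1 : q <= 1.
Proof. by rewrite -p_sum1 (bigD1 j) //= lerDl sumr_ge0. Qed.

Lemma sum_indicator (h : bool -> R) :
  \sum_a p a * h (a == j) = q * h true + (1 - q) * h false.
Proof.
rewrite (bigD1 j) //= eqxx; congr (_ + _).
rewrite (eq_bigr (fun a => p a * h false)) => [|a /negbTE -> //].
by rewrite -mulr_suml; congr (_ * _); rewrite -p_sum1 [in RHS](bigD1 j) //= addrAC subrr add0r.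
Qed.

Definition centered (s : seq T) : R := \sum_(a <- s) ((a == j)%:R - q).

Lemma centeredE s : centered s = (count_mem j s)%:R - (size s)%:R * q.
Proof.
rewrite /centered; elim: s => [|a s IHs] /=; first by rewrite big_nil mul0r subrr.
by rewrite big_cons IHs natrD -(nat1r (size s)); ring.
Qed.

Lemma centered_count n s :
  size s = n -> centered s = (count_mem j s)%:R - n%:R * q.
Proof. by move=> <-; exact: centeredE. Qed.

Lemma expect_centered n : expect n centered = 0.
Proof.
elim: n => [|n IHn] /=; first by rewrite /centered big_nil.
rewrite (eq_bigr (fun a => p a * ((a == j)%:R - q))) => [|a _]; last first.
  congr (_ * _); rewrite -[RHS]addr0 -IHn -[X in X + _](expect_cst n) -expectD.
  by apply: eq_expect => s _; rewrite /centered big_cons.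
by rewrite (sum_indicator (fun b : bool => b%:R - q)) /=; ring.
Qed.

Lemma expect_centered2 n :
  expect n (fun s => centered s ^+ 2) = n%:R * (q * (1 - q)).
Proof.
elim: n => [|n IHn] /=; first by rewrite /centered big_nil mul0r expr0n.
pose h (b : bool) := (b%:R - q) ^+ 2 + n%:R * (q * (1 - q)).
rewrite (eq_bigr (fun a => p a * h (a == j))) => [|a _]; last first.
  congr (_ * _); rewrite (@eq_expect _ _
    (fun s => ((a == j)%:R - q) ^+ 2 + (2 * ((a == j)%:R - q)) * centered s + centered s ^+ 2)).
    by rewrite !expectD expect_cst expectZ expect_centered IHn mulr0 addr0.
  by move=> s _; rewrite /centered big_cons; ring.
by rewrite sum_indicator /h -(nat1r n) /=; ring.
Qed.

Lemma expect_centered4 n :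
  expect n (fun s => centered s ^+ 4) <=
  3 * (n%:R * (q * (1 - q))) ^+ 2 + n%:R * (q * (1 - q)).
Proof.
elim: n => [|n IHn] /=; first by rewrite /centered big_nil mul0r !expr0n /= mulr0 addr0.
set M3 := expect n (fun s => centered s ^+ 3).
set M4 := expect n (fun s => centered s ^+ 4) in IHn *.
pose h (b : bool) := (b%:R - q) ^+ 4 + 6 * (b%:R - q) ^+ 2 * (n%:R * (q * (1 - q)))
  + 4 * (b%:R - q) * M3 + M4.
rewrite (eq_bigr (fun a => p a * h (a == j))) => [|a _]; last first.
  congr (_ * _); rewrite (@eq_expect _ _
    (fun s => ((a == j)%:R - q) ^+ 4 + (4 * ((a == j)%:R - q) ^+ 3) * centered s
     + (6 * ((a == j)%:R - q) ^+ 2) * centered s ^+ 2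
     + (4 * ((a == j)%:R - q)) * centered s ^+ 3 + centered s ^+ 4)).
    by rewrite !expectD expect_cst !expectZ expect_centered expect_centered2 mulr0 addr0.
  by move=> s _; rewrite /centered big_cons; ring.
rewrite sum_indicator /h -(nat1r n) /=.
have q1 := prob_le1; have q0 := p_ge0 j.
have v0 : 0 <= q * (1 - q) by rewrite mulr_ge0 ?subr_ge0.
rewrite -subr_ge0.
(* The third moment [M3] cancels because one centered draw has mean 0. With [w = q (1 - q)], its
   fourth moment is [w - 3 w^2], so the slack grows by [6 w^2] per draw. *)
have -> : 3 * ((1 + n%:R) * (q * (1 - q))) ^+ 2 + (1 + n%:R) * (q * (1 - q)) -
  (q * ((1 - q) ^+ 4 + 6 * (1 - q) ^+ 2 * (n%:R * (q * (1 - q))) +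
       4 * (1 - q) * M3 + M4) +
   (1 - q) * ((0 - q) ^+ 4 + 6 * (0 - q) ^+ 2 * (n%:R * (q * (1 - q))) +
       4 * (0 - q) * M3 + M4)) =
  (3 * (n%:R * (q * (1 - q))) ^+ 2 + n%:R * (q * (1 - q)) - M4)
  + 6 * (q * (1 - q)) ^+ 2 :> R by ring.
apply: addr_ge0; first by rewrite subr_ge0.
by rewrite mulr_ge0 ?sqr_ge0.
Qed.

(* With [t = |y| / r] this is [t (t - 1)^2 (t + 2) >= 0]. *)
Lemma norm_ge_quartic (y r : R) : 0 < r ->
  3 / (2 * r) * y ^+ 2 - (2 * r ^+ 3)^-1 * y ^+ 4 <= `|y|.
Proof.
move=> r0; have := normr_ge0 y; rewrite -(real_normK (num_real y)).
rewrite (_ : y ^+ 4 = `|y| ^+ 4); last first.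
  by rewrite -normrX ger0_norm // (exprM y 2 2) sqr_ge0.
move: `|y| => u u0; rewrite -subr_ge0.
have -> : u - (3 / (2 * r) * u ^+ 2 - (2 * r ^+ 3)^-1 * u ^+ 4) =
  u * (u - r) ^+ 2 * (u + 2 * r) / (2 * r ^+ 3) by field; rewrite gt_eqF.
apply: divr_ge0; last by rewrite mulr_ge0 ?exprn_ge0 // ltW.
apply: mulr_ge0; first by rewrite mulr_ge0 ?sqr_ge0.
by rewrite addr_ge0 // pmulr_rge0 // ltW.
Qed.

(** Averages the quartic minorant of the absolute value at [r^2 = 3 v + 1]: the fourth moment is at
    most [v r^2], which leaves [3 v / (2 r) - v / (2 r) = v / r]. *)
Lemma expect_norm_centered_ge n (v := n%:R * (q * (1 - q))) :
  v / Num.sqrt (3 * v + 1) <= expect n (fun s => `|centered s|).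
Proof.
have q1 := prob_le1; have q0 := p_ge0 j.
have v0 : 0 <= v by rewrite !mulr_ge0 ?subr_ge0.
have w0 : 0 < 3 * v + 1 by lra.
set r := Num.sqrt _; have r0 : 0 < r by rewrite sqrtr_gt0.
have r2 : r ^+ 2 = 3 * v + 1 by rewrite sqr_sqrtr // ltW.
apply: le_trans (le_expect _ _ _ (fun s _ => norm_ge_quartic (centered s) _ r0)).
rewrite expectB !expectZ expect_centered2 -/v.
have /le_trans -> // : v / r <= 3 / (2 * r) * v - (2 * r ^+ 3)^-1 * (3 * v ^+ 2 + v).
  have -> : 3 * v ^+ 2 + v = v * r ^+ 2 by rewrite r2; ring.
  by rewrite (_ : _ - _ = v / r) //; field; rewrite gt_eqF.
rewrite lerD2l lerN2; apply: ler_wpM2l (expect_centered4 n).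
by rewrite invr_ge0 mulr_ge0 ?exprn_ge0 // ltW.
Qed.

Lemma expect_count n : expect n (fun s => (count_mem j s)%:R) = n%:R * q.
Proof.
rewrite (@eq_expect _ _ (fun s => centered s + n%:R * q)).
  by rewrite expectD expect_cst expect_centered add0r.
by move=> s <-; rewrite centeredE subrK.
Qed.

Lemma expect_sqrt_count_le n :
  expect n (fun s => Num.sqrt (count_mem j s)%:R) <= n%:R * q.
Proof.
by rewrite -expect_count; apply: le_expect => s _; exact: sqrt_nat_le.
Qed.

(** Jensen's inequality for the square root, through its tangent line at the mean [a^2 = n q]. A
    vanishing mean is treated apart, since the slope [1 / (2 a)] needs [a > 0]. *)
Lemma expect_sqrt_count_le_sqrt n :
  expect n (fun s => Num.sqrt (count_mem j s)%:R) <= Num.sqrt (n%:R * q).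
Proof.
have x0 : 0 <= n%:R * q by rewrite mulr_ge0.
have [xp|] := ltP 0 (n%:R * q); last first.
  by move=> xle; apply: le_trans (expect_sqrt_count_le n) (le_trans xle (sqrtr_ge0 _)).
set a := Num.sqrt (n%:R * q); have a0 : 0 < a by rewrite sqrtr_gt0.
have a2 : a ^+ 2 = n%:R * q by rewrite sqr_sqrtr.
have -> : a = expect n (fun s => (2 * a)^-1 * (count_mem j s)%:R + a / 2).
  rewrite expectD expect_cst expectZ expect_count -a2; field.
  by rewrite gt_eqF.
apply: le_expect => s _; move: (count_mem j s) => k.
have := sqr_sqrtr (ler0n R k); move: (Num.sqrt _) => u <-.
rewrite -subr_ge0.
have -> : (2 * a)^-1 * u ^+ 2 + a / 2 - u = (u - a) ^+ 2 / (2 * a).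
  by field; rewrite gt_eqF.
by rewrite divr_ge0 ?sqr_ge0 // mulr_ge0 // ltW.
Qed.

Lemma expect_coordinate_ge n (c : R) : 0 <= c -> c ^+ 2 = 1 / 8 ->
  - (Num.sqrt n%:R * q) <=
  expect n (fun s => `|(count_mem j s)%:R - n%:R * q|
                     - c * Num.sqrt (count_mem j s)%:R).
Proof.
move=> c0 c2; have q1 := prob_le1; have q0 := p_ge0 j.
have n0 : 0 <= n%:R :> R by [].
(* A rational upper bound for [c = 1 / (2 sqrt 2)]; twice it is the [3 / 4] that appears below for
   light symbols. *)
have c38 : c <= 3 / 8.
  by rewrite -(@ler_pXn2r _ 2) ?nnegrE // c2; lra.
rewrite expectB expectZ.
set E1 := expect n _; set E2 := expect n _.
have E1ge : n%:R * (q * (1 - q)) / Num.sqrt (3 * (n%:R * (q * (1 - q))) + 1) <= E1.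
  apply: le_trans (expect_norm_centered_ge n) _.
  by apply: le_expect => s /centered_count ->.
have E1ge0 : 0 <= E1 by rewrite -(expect_cst n 0); exact: le_expect.
have E20 : 0 <= E2.
  by rewrite -(expect_cst n 0); apply: le_expect => s _; exact: sqrtr_ge0.
have E2x : E2 <= n%:R * q := expect_sqrt_count_le n.
have E2s : E2 <= Num.sqrt (n%:R * q) := expect_sqrt_count_le_sqrt n.
(* For a heavy symbol [c^2 = 1/8 <= q], so [c sqrt (n q) <= q sqrt n]. For a light one [1 - q]
   exceeds [3/4], and the deviation alone pays for the square root. *)
have [q8|q8] := leP (1 / 8) q.
  have cq : c <= Num.sqrt q.
    by rewrite -(ger0_norm c0) -sqrtr_sqr ler_wsqrtr // c2.
  have : c * E2 <= Num.sqrt n%:R * q; last by lra.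
  apply: le_trans (ler_wpM2l c0 E2s) _.
  rewrite sqrtrM // mulrCA; apply: ler_wpM2l; first exact: sqrtr_ge0.
  rewrite -[leRHS](sqr_sqrtr q0) expr2; apply: ler_wpM2r cq.
  exact: sqrtr_ge0.
have snq : 0 <= Num.sqrt n%:R * q by rewrite mulr_ge0 ?sqrtr_ge0.
suff : c * E2 <= E1 by lra.
apply: le_trans E1ge; set v := n%:R * (q * (1 - q)); set x := n%:R * q in E2x E2s *.
have x0 : 0 <= x by rewrite mulr_ge0.
have vx : v = x * (1 - q) by rewrite /v /x mulrA.
have xv : 3 / 4 * x <= v.
  by rewrite vx mulrC; apply: ler_wpM2l => //; lra.
have vlex : v <= x by rewrite vx ler_piMr //; lra.
have w0 : 0 < 3 * v + 1 by lra.
have s0 : 0 < Num.sqrt (3 * v + 1) by rewrite sqrtr_gt0.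
rewrite ler_pdivlMr //; apply: le_trans xv.
have sq4 : Num.sqrt 4 = 2 :> R.
  by rewrite (_ : 4 = 2 ^+ 2 :> R) ?sqrtr_sqr ?ger0_norm //; ring.
(* For a mean count [x <= 1] the bound [E2 <= x] is the sharp one and the root is at most 2; beyond
   1, [E2 <= sqrt x] and the root is at most [2 sqrt x]. Both cases give [3/4 x]. *)
have [x1|x1] := leP x 1.
  have sle2 : Num.sqrt (3 * v + 1) <= 2 by rewrite -sq4 ler_wsqrtr //; lra.
  apply: (@le_trans _ _ (3 / 8 * x * 2)); last by lra.
  by apply: ler_pM => //; [exact: mulr_ge0 | exact: ler_pM].
have sle : Num.sqrt (3 * v + 1) <= 2 * Num.sqrt x.
  by rewrite -sq4 -sqrtrM // ler_wsqrtr //; lra.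
apply: (@le_trans _ _ (3 / 8 * Num.sqrt x * (2 * Num.sqrt x))).
  by apply: ler_pM => //; [exact: mulr_ge0 | exact: ler_pM].
have := sqr_sqrtr x0; lra.
Qed.

End OneSymbol.

(** * The sum over symbols: mean, sensitivity and lower tail *)

Definition discrepancy (J : pred T) (c : R) (m : nat) (s : seq T) : R :=
  \sum_(j | J j) (`|(count_mem j s)%:R - m%:R * p j|
                  - c * Num.sqrt (count_mem j s)%:R).

Lemma sum_indicator_le1 (J : pred T) (x : T) : \sum_(j | J j) (x == j)%:R <= 1 :> R.
Proof.
apply: (@le_trans _ _ (\sum_j (x == j)%:R)).
  by rewrite [leRHS](bigID J) /= lerDl sumr_ge0.
by rewrite (bigD1 x) //= eqxx big1 ?addr0 // => j /negbTE; rewrite eq_sym => ->.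
Qed.

Lemma sum_count_le (J : pred T) (s : seq T) :
  \sum_(j | J j) (count_mem j s)%:R <= (size s)%:R :> R.
Proof.
elim: s => [|a s IHs] /=; first by rewrite big1.
under eq_bigr do rewrite natrD.
by rewrite big_split /= -nat1r lerD // sum_indicator_le1.
Qed.

Lemma sqrt_natS_le (n : nat) : Num.sqrt n.+1%:R <= Num.sqrt n%:R + 1 :> R.
Proof.
have n0 : 0 <= Num.sqrt n%:R :> R := sqrtr_ge0 _.
rewrite -[leRHS]ger0_norm ?addr_ge0 // -sqrtr_sqr ler_wsqrtr //.
rewrite sqrrD sqr_sqrtr // expr1n mulr1 -natr1 -addrA lerD2l.
by rewrite lerDr mulrn_wge0.
Qed.

(** Replacing [a] by [b] changes only the counts of these two symbols, each by one. Each term then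
    moves by at most [1 + 3/8 = 11/8]. The sign is reversed because the lower tail is the one
    needed. *)
Lemma discrepancy_bounded_differences J (c : R) m : 0 <= c -> c <= 3 / 8 ->
  bounded_differences (11 / 4) (fun s => - discrepancy J c m s).
Proof.
move=> c0 c38 s1 s2 a b.
pose h j (k : nat) := `|k%:R - m%:R * p j| - c * Num.sqrt k%:R.
have hS j k : `|h j k.+1 - h j k| <= 11 / 8.
  have mono : Num.sqrt k%:R <= Num.sqrt k.+1%:R :> R by rewrite ler_wsqrtr // ler_nat.
  have := sqrt_natS_le k; move: mono; rewrite /h.
  move: (Num.sqrt k%:R) (Num.sqrt k.+1%:R) => x y xy yx.
  have d : `| `|k.+1%:R - m%:R * p j| - `|k%:R - m%:R * p j| | <= 1.
    apply: le_trans (ler_dist_dist _ _) _.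
    by rewrite -(natr1 k) (_ : _ - _ = 1) ?normr1 //; ring.
  have cy : c * (y - x) <= 3 / 8.
    by rewrite -[leRHS]mulr1; apply: ler_pM => //; lra.
  have cy0 : 0 <= c * (y - x) by rewrite mulr_ge0 // subr_ge0.
  move: d; rewrite !ler_norml => /andP[d1 d2]; apply/andP; split; lra.
have hab j k : `|h j (k + (a == j))%N - h j (k + (b == j))%N| <=
    11 / 8 * ((a == j)%:R + (b == j)%:R).
  case: (a == j); case: (b == j); rewrite ?addn0 ?addn1 ?subrr ?normr0 /=.
  - lra.
  - by rewrite addr0 mulr1.
  - by rewrite add0r mulr1 distrC.
  - lra.
have cE (x j : T) : count_mem j (s1 ++ x :: s2) =
    (count_mem j s1 + count_mem j s2 + (x == j))%N.
  by rewrite count_cat /= (addnC (x == j : nat)) addnA.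
rewrite /discrepancy opprK addrC -sumrB.
apply: le_trans (ler_norm_sum _ _ _) _.
apply: (@le_trans _ _ (\sum_(j | J j) 11 / 8 * ((a == j)%:R + (b == j)%:R))).
  apply: ler_sum => j _; rewrite !cE -/(h j _) -/(h j _) distrC; exact: hab.
rewrite -mulr_sumr big_split /=; have := sum_indicator_le1 J a; have := sum_indicator_le1 J b; lra.
Qed.

Lemma expect_discrepancy_ge J (c : R) m : 0 <= c -> c ^+ 2 = 1 / 8 ->
  - Num.sqrt m%:R <= expect m (discrepancy J c m).
Proof.
move=> c0 c2; rewrite expect_sum.
apply: le_trans (ler_sum _ (fun j _ => expect_coordinate_ge j m c c0 c2)).
rewrite sumrN lerN2 -mulr_sumr ler_piMr ?sqrtr_ge0 //.
by rewrite -p_sum1 [leRHS](bigID J) /= lerDl sumr_ge0.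
Qed.

(** A deterministic floor, which rules out the bad event when the deviation allowed is large. *)
Lemma discrepancy_ge J (c : R) m s : 0 <= c -> c <= 3 / 8 -> size s = m ->
  - (3 / 8 * m%:R) <= discrepancy J c m s.
Proof.
move=> c0 c38 sm.
apply: (@le_trans _ _ (\sum_(j | J j) - (3 / 8 * (count_mem j s)%:R))).
  rewrite sumrN lerN2 -mulr_sumr; apply: ler_wpM2l; first lra.
  by rewrite -sm; exact: sum_count_le.
apply: ler_sum => j _.
have sk : Num.sqrt (count_mem j s)%:R <= (count_mem j s)%:R :> R.
  exact: sqrt_nat_le.
have : c * Num.sqrt (count_mem j s)%:R <= 3 / 8 * (count_mem j s)%:R.
  by apply: ler_pM => //; exact: sqrtr_ge0.
have := normr_ge0 ((count_mem j s)%:R - m%:R * p j); lra.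
Qed.

(* The Chernoff parameter [2 / 5 * rho] is close to the optimal one for the
   difference bound [11 / 4]. *)
Lemma discrepancy_tail J (c delta : R) m
    (rho := Num.sqrt (ln (2 / delta) / m%:R)) :
  (0 < m)%N -> 0 < delta < 1 -> 0 <= c -> c ^+ 2 = 1 / 8 ->
  expect m (fun s => (discrepancy J c m s < - (6 * m%:R * rho))%R%:R) <= delta.
Proof.
move=> m_gt0 /andP[d0 d1] c0 c2.
have mp : 0 < m%:R :> R by rewrite ltr0n.
have c38 : c <= 3 / 8 by rewrite -(@ler_pXn2r _ 2) ?nnegrE // c2; lra.
have ln2 : 1 / 2 <= ln 2 :> R.
  have := expR_ge1Dx (- ln 2 : R); rewrite expRN lnK ?posrE //; lra.
have LE : ln (2 / delta) = ln 2 - ln delta :> R by rewrite ln_div ?posrE.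
have lnd : ln delta < 0 by rewrite ln_lt0 ?d0.
have L0 : 0 <= ln (2 / delta) by rewrite LE; lra.
have rho0 : 0 <= rho by exact: sqrtr_ge0.
(* Above [3/10] the threshold [- 6 m rho] lies below the floor [- 3/8 m]. Up to [3/10],
   [l * 11/4 = 11/10 * rho] stays below [1/3], as the exponential bound requires. *)
have [rho3|rho3] := ltP (3 / 10) rho.
  rewrite (@eq_expect _ _ (fun=> 0)) ?expect_cst ?ltW // => s sm.
  have := discrepancy_ge J c m s c0 c38 sm.
  have : 3 / 10 * m%:R <= rho * m%:R by rewrite ler_pM2r // ltW.
  case: ltP => // *; exfalso; lra.
pose l : R := 2 / 5 * rho; have l0 : 0 <= l by rewrite mulr_ge0.
apply: (@le_trans _ _ (expR (- (l * (6 * m%:R * rho))) *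
    expect m (fun s => expR (l * - discrepancy J c m s)))).
  (* Markov's inequality, pointwise: the tilted exponential dominates the indicator of the tail. *)
  rewrite -expectZ; apply: le_expect => s _; rewrite -expRD.
  case: ltP => [lt|_]; last exact: expR_ge0.
  apply: le_trans (expR_ge1Dx _); rewrite lerDl.
  by rewrite -mulrN -mulrDr mulr_ge0 //; lra.
have lD : l * (11 / 4) <= 1 / 3 by rewrite /l; lra.
have := expect_expR_le l (11 / 4) m _ l0 lD
  (discrepancy_bounded_differences J c m c0 c38).
rewrite expectN => H; apply: le_trans (ler_wpM2l (expR_ge0 _) H) _.
rewrite -expRD -[leRHS]lnK ?posrE // ler_expR.
set u := Num.sqrt (ln (2 / delta)).
have u2 : u ^+ 2 = ln (2 / delta) by exact: sqr_sqrtr.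
have smr : Num.sqrt m%:R * rho = u.
  by rewrite -sqrtrM ?ler0n // mulrC divfK // gt_eqF.
have mr2 : m%:R * rho ^+ 2 = u ^+ 2.
  by rewrite u2 sqr_sqrtr ?divr_ge0 // mulrC divfK // gt_eqF.
have Eg : l * - expect m (discrepancy J c m) <= 2 / 5 * u.
  have Em : - expect m (discrepancy J c m) <= Num.sqrt m%:R.
    by rewrite lerNl; exact: expect_discrepancy_ge.
  have := ler_wpM2l rho0 Em; rewrite (mulrC rho (Num.sqrt _)) smr /l; lra.
have -> : ln delta = ln 2 - u ^+ 2 by rewrite u2 LE; lra.
have -> : - (l * (6 * m%:R * rho)) = - (12 / 5) * (m%:R * rho ^+ 2) by rewrite /l; ring.
have -> : m%:R * (l ^+ 2 * (11 / 4) ^+ 2) = 121 / 100 * (m%:R * rho ^+ 2).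
  by rewrite /l; field.
(* What remains is [2/5 u - 19/100 u^2 <= ln 2]. The left side peaks at [u = 20/19] with value
   [4/19], below [1/2 <= ln 2]; the 2 inside the logarithm thus absorbs the mean. *)
rewrite mr2; have := sqr_ge0 (u - 20 / 19); rewrite sqrrB; lra.
Qed.

End ProductExpectation.
Arguments expect {R T} p n f.
Arguments discrepancy {R T} p J c m s.

(** * Series and countable sums compared with finite ones *)

Lemma lim_series_finite (R : realType) (u : nat -> R) (K : nat) :
  (forall i, (K <= i)%N -> u i = 0) ->
  (series u n @[n --> \oo] --> (\sum_(i < K) u i : R))%classic.
Proof.
move=> u0; apply: cvg_near_cst; exists K => // n /= Kn.
rewrite /series /= (big_cat_nat (leq0n K) Kn) big_mkord /=.
rewrite big_nat_cond [X in _ + X]big1 ?addr0 // => i /andP[/andP[Ki _] _].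
exact: u0.
Qed.

Lemma lim_series_ge (R : realType) (u : nat -> R) (K : nat) :
  (forall i, 0 <= u i) -> cvgn (series u) ->
  \sum_(i < K) u i <= limn (series u).
Proof.
move=> u0 cu; have := @nondecreasing_cvgn_le R (series u) _ cu K.
rewrite /series /= big_mkord; apply.
by apply: nondecreasing_series => i _ _; exact: u0.
Qed.

(** The countable sum is a supremum over finite sets of samples, so any injectively indexed finite
    family inside the event bounds it from below. *)
Lemma prob_prod_ge_finite (R : realType) (m : nat) (mu : nat -> R)
    (E : {ffun 'I_m -> nat} -> Prop) (T : finType) (P : pred T)
    (e : T -> {ffun 'I_m -> nat}) :
  injective e -> (forall t, P t -> E (e t)) ->
  ((\sum_(t | P t) \prod_(i < m) mu (e t i))%:E <= prob_prod mu E)%E.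
Proof.
move=> inj_e PE; apply: esum_ge; exists [set` [seq e t | t <- enum P]]%classic.
  split; first exact: finite_seq.
  by move=> x /= /mapP[t]; rewrite mem_enum => Pt ->; exact: PE.
rewrite -fsbig_seq; last by rewrite map_inj_uniq ?enum_uniq.
by rewrite big_map big_enum /= sumEFin.
Qed.

(** * Reduction to a finite alphabet *)

Section Truncation.
Variables (R : realType) (mu : nat -> R).
Hypothesis mu_distr : is_distribution mu.
Variable K : nat.

Lemma partial_sum_le1 : \sum_(i < K) mu i <= 1.
Proof.
case: mu_distr => mu0 cmu; rewrite -(cvg_lim _ cmu) //.
by apply: lim_series_ge => //; apply/cvg_ex; exists 1.
Qed.

(* The last symbol carries the mass of all integers from [K] on. *)
Definition truncated (a : 'I_K.+1) : R :=
  if (a < K)%N then mu a else 1 - \sum_(i < K) mu i.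

Lemma truncated_ge0 a : 0 <= truncated a.
Proof.
rewrite /truncated; case: ifP => _; first by case: mu_distr.
by rewrite subr_ge0 partial_sum_le1.
Qed.

Lemma truncated_max : truncated ord_max = 1 - \sum_(i < K) mu i.
Proof. by rewrite /truncated ltnn. Qed.

Lemma truncated_sum1 : \sum_a truncated a = 1.
Proof.
rewrite big_ord_recr /= truncated_max.
rewrite (eq_bigr (fun i : 'I_K => mu i)) ?subrKC // => i _.
by rewrite /truncated /= ltn_ord.
Qed.

Definition tuple_sample m (t : m.-tuple 'I_K.+1) : {ffun 'I_m -> nat} :=
  [ffun i => val (tnth t i)].

Lemma tuple_sample_inj m : injective (@tuple_sample m).
Proof.
move=> t1 t2 /ffunP eqt; apply: eq_from_tnth => i.
by apply: val_inj; have := eqt i; rewrite !ffunE.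
Qed.

Lemma empirical_tuple_sample m (t : m.-tuple 'I_K.+1) (a : 'I_K.+1) :
  empirical R (tuple_sample m t) a = (count_mem a t)%:R / m%:R.
Proof.
rewrite /empirical; congr (_ / _).
rewrite -sum1_count natr_sum big_tuple [RHS]big_mkcond.
by apply: eq_bigr => i _ /=; rewrite ffunE val_eqE; case: eqP.
Qed.

Lemma tnth_lt m (t : m.-tuple 'I_K.+1) i : ord_max \notin t -> (tnth t i < K)%N.
Proof.
move=> tK; have := ltn_ord (tnth t i).
rewrite ltnS leq_eqVlt => /orP[/eqP eqK|//].
by case/negP: tK; apply/tnthP; exists i; apply: val_inj.
Qed.

Lemma empirical_tuple_sample0 m (t : m.-tuple 'I_K.+1) i :
  ord_max \notin t -> (K <= i)%N -> empirical R (tuple_sample m t) i = 0.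
Proof.
move=> tK Ki; rewrite /empirical big1 ?mul0r // => u _; rewrite ffunE.
by rewrite ltn_eqF // (leq_trans (tnth_lt m t u tK)).
Qed.

(** Without the overflow symbol, the empirical measure vanishes from [K] on: the sum in [Phi] is
    finite, and the total variation is at least its part below [K]. *)
Lemma tv_dist_ge_discrepancy m (t : m.-tuple 'I_K.+1) (rho : R)
    (c := 1 / (2 * Num.sqrt 2)) :
  (0 < m)%N -> ord_max \notin t ->
  - (6 * m%:R * rho) <=
    discrepancy truncated (fun a : 'I_K.+1 => (a < K)%N) c m t ->
  1 / (4 * Num.sqrt 2) * Phi m (empirical R (tuple_sample m t)) - 3 * rho
    <= tv_dist (empirical R (tuple_sample m t)) mu.
Proof.
move=> m_gt0 tK; set emp := empirical R _.
have mp : 0 < m%:R :> R by rewrite ltr0n.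
have [mu0 cmu] := mu_distr.
have emp_ge0 i : 0 <= emp i by rewrite divr_ge0 // sumr_ge0.
have emp0 i : (K <= i)%N -> emp i = 0 by exact: empirical_tuple_sample0.
have cemp : cvgn (series emp) by apply/cvg_ex; exists (\sum_(i < K) emp i);
  exact: lim_series_finite.
(* Convergence makes [limn] a genuine limit that dominates its partial sums; it follows by
   domination by [emp + mu]. *)
have cdiff : cvgn (series (fun i => `|emp i - mu i|)).
  apply: (@series_le_cvg R _ (emp + mu)) => // [i|i|].
  - by rewrite addr_ge0.
  - by apply: le_trans (ler_normB _ _) _; rewrite !ger0_norm.
  - by apply: is_cvg_seriesD => //; apply/cvg_ex; exists 1.
have tvge := lim_series_ge R _ K (fun i => normr_ge0 (emp i - mu i)) cdiff.
have sqrt0 i : (K <= i)%N -> Num.sqrt (emp i) = 0 by move=> /emp0 ->; rewrite sqrtr0.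
rewrite /Phi /tv_dist (cvg_lim _ (lim_series_finite _ _ _ sqrt0)) //.
set V := limn _ in tvge *; set W := \sum_(i < K) Num.sqrt (emp i).
set V' := \sum_(i < K) _ in tvge.
have -> : discrepancy truncated (fun a : 'I_K.+1 => (a < K)%N) c m t =
    m%:R * V' - c * (Num.sqrt m%:R * W).
  rewrite /discrepancy big_mkcond big_ord_recr /= ltnn addr0.
  rewrite /V' /W !mulr_sumr -sumrB; apply: eq_bigr => i _; rewrite ltn_ord.
  have ei : (count_mem (widen_ord (leqnSn K) i) t)%:R = m%:R * emp i.
    have := empirical_tuple_sample m t (widen_ord (leqnSn K) i).
    by rewrite /= -/emp => ->; rewrite mulrC divfK // gt_eqF.
  rewrite ei /truncated /= ltn_ord -mulrBr normrM ger0_norm ?ler0n //.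
  by rewrite sqrtrM ?ler0n.
set r := Num.sqrt m%:R.
have rp : 0 < r by rewrite sqrtr_gt0.
have r2 : r ^+ 2 = m%:R by rewrite sqr_sqrtr // ltW.
have mV : m%:R * V' <= m%:R * V by apply: ler_wpM2l tvge; exact: ltW.
move=> disc_ge.
have cE : 1 / (4 * Num.sqrt 2) = c / 2 :> R.
  by rewrite /c; field; rewrite gt_eqF // sqrtr_gt0.
(* Scaling by [2 m] and using [m = r^2] turns the claim into the bound on the discrepancy. *)
rewrite cE -(ler_pM2l (mulr_gt0 (ltr0Sn R 1) mp)).
have -> : 2 * m%:R * (c / 2 * (r^-1 * W) - 3 * rho) =
    c * (r * W) - 6 * m%:R * rho :> R.
  by rewrite -r2; field; rewrite gt_eqF.
have -> : 2 * m%:R * (2^-1 * V) = m%:R * V :> R by field.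
lra.
Qed.

(** A union bound: a sample fails only if its discrepancy is too low or it contains the overflow
    symbol, whose expected count is [m] times the tail mass. *)
Lemma prob_prod_ge_truncated (m : nat) (delta : R) :
  (0 < m)%N -> 0 < delta < 1 ->
  ((1 - delta - m%:R * (1 - \sum_(i < K) mu i))%:E <=
   @prob_prod R m mu (fun x =>
     ((1 / (4 * Num.sqrt 2)) * Phi m (empirical R x)
       - 3 * Num.sqrt (ln (2 / delta) / m%:R)
     <= tv_dist (empirical R x) mu)%R))%E.
Proof.
move=> m_gt0 d01; set rho := Num.sqrt (_ / _).
pose c : R := 1 / (2 * Num.sqrt 2).
have c0 : 0 <= c by rewrite divr_ge0 ?mulr_ge0 ?sqrtr_ge0.
have c2 : c ^+ 2 = 1 / 8.
  by rewrite /c expr_div_n exprMn sqr_sqrtr //; field.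
(* Excludes the overflow symbol, which stands for no single integer. *)
pose J (a : 'I_K.+1) := (a < K)%N.
pose bad s := discrepancy truncated J c m s < - (6 * m%:R * rho).
pose good (t : m.-tuple 'I_K.+1) := ~~ bad t && (ord_max \notin t).
set E := (X in prob_prod _ X).
have goodE t : good t -> E (tuple_sample m t).
  move=> /andP[nbad tK]; apply: tv_dist_ge_discrepancy => //.
  by rewrite leNgt.
apply/(le_trans _ (prob_prod_ge_finite R m mu E _ good _ (tuple_sample_inj m) goodE)).
rewrite lee_fin.
have p0 := truncated_ge0; have p1 := truncated_sum1.
have tail := discrepancy_tail R _ _ p0 p1 J c delta m m_gt0 d01 c0 c2.
(* This integrand is at most the indicator of [good], because the overflow count is at least 1
   whenever that symbol occurs. *)
apply: (@le_trans _ _ (expect truncated m (fun s =>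
    1 - (bad s)%:R - (count_mem ord_max s)%:R))).
  rewrite !expectB expect_cst // expect_count // truncated_max.
  by rewrite lerB // lerB.
rewrite expect_tuple big_mkcond /=.
rewrite [leRHS]big_mkcond; apply: ler_sum => t _ /=.
case: ifP => [/andP[/negbTE nbad tK]|/negbT].
  (* On good samples all letters are below [K], where the truncated weights agree with [mu]. *)
  rewrite nbad (count_memPn tK) !subr0 mulr1.
  rewrite le_eqVlt; apply/orP; left; apply/eqP; apply: eq_bigr => i _.
  by rewrite ffunE /truncated tnth_lt.
rewrite negb_and !negbK => nb; rewrite mulr_ge0_le0 ?prodr_ge0 //.
case/orP: nb => [->|].
  by rewrite subrr sub0r oppr_le0.
rewrite -has_pred1 has_count -(ler_nat R) => ct.
have : 0 <= (bad t)%:R :> R by [].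
lra.
Qed.

End Truncation.

(** * Letting the truncation level grow *)

Theorem theorem2 (R : realType) (m : nat) (delta : R) (mu : nat -> R) :
  (0 < m)%N -> 0 < delta < 1 -> is_distribution mu ->
  ((1 - delta)%:E <=
   @prob_prod R m mu (fun x =>
     ((1 / (4 * Num.sqrt 2)) * Phi m (empirical R x)
       - 3 * Num.sqrt (ln (2 / delta) / m%:R)
     <= tv_dist (empirical R x) mu)%R))%E.
Proof.
move=> m_gt0 d01 mu_distr; have [mu0 cmu] := mu_distr.
have mp : 0 < m%:R :> R by rewrite ltr0n.
apply/lee_addgt0Pr => e e0.
(* [K] is taken so large that the tail mass is below [e / m], which makes the overflow loss less
   than [e]. *)
have [K _ /(_ K (leqnn K))] : (\forall n \near \oo, `|1 - series mu n| < e / m%:R)%classic.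
  by apply: cvgr_dist_lt => //; rewrite divr_gt0.
rewrite /= /series /= big_mkord => /(le_lt_trans (ler_norm _)).
rewrite ltr_pdivlMr // mulrC => me.
have := prob_prod_ge_truncated R mu mu_distr K m delta m_gt0 d01.
move/(leeD2r e%:E); apply: le_trans.
by rewrite -EFinD lee_fin; lra.
Qed.
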